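(* Let $G=(V,E)$ be a finite, connected, undirected, unweighted graph with $n=|V|$ vertices. Let $0=\lambda_1\leq \lambda_2\leq \cdots\leq \lambda_n$ be the eigenvalues of the normalized Laplacian $\mathcal{L}=I-D^{-1/2}AD^{-1/2}$ of $G$, where $A$ is the adjacency matrix and $D$ the diagonal matrix of vertex degrees. Then for every $k$ with $2\leq k\leq n$, $$\operatorname{diam}(G)\leq \frac{48\,k\log n}{\lambda_k}.$$
   Context: $\operatorname{diam}(G)=\max_{u,v\in V}\operatorname{dist}(u,v)$, where $\operatorname{dist}(u,v)$ is the length (number of edges) of a shortest path from $u$ to $v$. Here $\log$ denotes the natural logarithm. *)

(* Defs.v *)
From HB Require Import structures.
From mathcomp Require Import all_boot all_order all_algebra.
From mathcomp Require Import reals exp.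
Set Implicit Arguments.
Unset Strict Implicit.
Unset Printing Implicit Defensive.
Import Order.TTheory GRing.Theory Num.Theory.
Local Open Scope ring_scope.

(* A simple graph is given by a symmetric irreflexive adjacency relation [e]
   on a finite type [V] of vertices. *)

Section Distance.
Variables (V : finType) (e : rel V).

Definition graph_connected : Prop := forall u v : V, connect e u v.

Definition has_path (u v : V) (d : nat) : bool :=
  [exists p : d.-tuple V, [&& path e u p, last u p == v & uniq (u :: p)]].

(* The vertices of a path are distinct, so its length is less than #|V|; the
   default value #|V| is only taken when no path joins u to v. *)
Definition dist (u v : V) : nat :=
  \big[minn/#|V|]_(d < #|V| | has_path u v d) (d : nat).

Definition diam : nat := \max_(u : V) \max_(v : V) dist u v.

Definition degree (u : V) : nat := #|[set v | e u v]|.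

End Distance.

Section Laplacian.
Variables (R : realType) (V : finType) (e : rel V).

(* Rows and columns are indexed by the vertices through [enum_val]. *)
Definition adjacency_mx : 'M[R]_#|V| :=
  \matrix_(i, j) (e (enum_val i) (enum_val j))%:R.

(* D^(-1/2); an isolated vertex gets the entry 0, since 0^-1 = 0. *)
Definition degree_invsqrt_mx : 'M[R]_#|V| :=
  diag_mx (\row_i (Num.sqrt (degree e (enum_val i))%:R)^-1).

Definition normalized_laplacian : 'M[R]_#|V| :=
  1%:M - degree_invsqrt_mx *m adjacency_mx *m degree_invsqrt_mx.

End Laplacian.

(* [s] lists the eigenvalues of [M] in nondecreasing order, each repeated
   according to its multiplicity as a root of the characteristic polynomial. *)
Definition ordered_eigenvalues (R : realType) (n : nat) (M : 'M[R]_n)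
    (s : n.-tuple R) : Prop :=
  sorted <=%R s /\ char_poly M = \prod_(x <- s) ('X - x%:P).

(* Main.v *)
(* Fix u and v at distance d = diam(G), let h = dist(u, .), and let r be about
   d / (2(k - 1)).  For j < k and i < r consider the bands
   S_(j,i) = {x : |h x - 2rj| <= i}.  Bands with distinct j are disjoint and not
   joined by an edge, so the vectors D^(1/2) 1_S on one band for each j are
   orthogonal, and orthogonal for the Laplacian form; by the min-max principle
   some j satisfies lambda_k vol(S_(j,i)) <= |boundary S_(j,i)| for all i < r.
   The boundary edges of S_(j,i) end in S_(j,i+1) \ S_(j,i), so the volume grows
   by a factor 1 + lambda_k at each step and (1 + lambda_k)^r <= n^2.  As
   0 < lambda_k <= 2, this gives r lambda_k <= 6 log n. *)

Require Import Defs.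
From HB Require Import structures.
From mathcomp Require Import all_boot all_order all_algebra.
From mathcomp Require Import perm spectral sesquilinear complex.
From mathcomp Require Import reals exp.
From mathcomp Require Import ring lra zify.
Set Implicit Arguments.
Unset Strict Implicit.
Unset Printing Implicit Defensive.
Import Order.TTheory GRing.Theory Num.Theory.
Local Open Scope ring_scope.

(** * Characteristic polynomials and their roots *)

Lemma perm_eq_prod_XsubC (F : idomainType) (s t : seq F) :
  \prod_(x <- s) ('X - x%:P) = \prod_(x <- t) ('X - x%:P) -> perm_eq s t.
Proof.
elim: s t => [|a s IHs] t.
  rewrite big_nil => /(congr1 (fun p : {poly F} => size p)).
  by rewrite size_prod_XsubC size_poly1 => -[/esym/size0nil->].
move=> Est; have a_in_t : a \in t.
  by rewrite -root_prod_XsubC -Est root_prod_XsubC mem_head.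
rewrite perm_sym (perm_trans (perm_to_rem a_in_t)) // perm_cons perm_sym.
apply: IHs; move: Est; rewrite (perm_big _ (perm_to_rem a_in_t)) !big_cons.
by apply: mulfI; rewrite polyXsubC_eq0.
Qed.

(** [P] also intertwines [X - A] and [X - B]; taking determinants, the nonzero constant [\det P]
    cancels. *)
Lemma char_poly_intertwine (F : fieldType) n (P A B : 'M[F]_n) :
  P \in unitmx -> P *m A = B *m P -> char_poly A = char_poly B.
Proof.
move=> uP PA; have detP0 : \det (map_mx (polyC : F -> {poly F}) P) != 0.
  by rewrite det_map_mx polyC_eq0 -unitfE -unitmxE.
apply: (mulfI detP0); rewrite [RHS]mulrC /char_poly -!det_mulmx; congr (\det _).
rewrite /char_poly_mx mulmxBr mulmxBl -!map_mxM PA; congr (_ - _).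
by rewrite mul_mx_scalar mul_scalar_mx.
Qed.

(** * Real and imaginary parts of complex matrices *)

Section RealMatrix.
Variables (R : rcfType) (m n p : nat) (A : 'M[R[i]]_(m, n)) (B : 'M[R]_(n, p)).

Lemma map_mx_Re_mulmx :
  map_mx (@complex.Re R) (A *m map_mx (real_complex R) B)
    = map_mx (@complex.Re R) A *m B.
Proof.
apply/matrixP => i j; rewrite [LHS]mxE 2!mxE raddf_sum; apply: eq_bigr => l _.
rewrite [map_mx _ B _ _]mxE [map_mx _ A _ _]mxE.
by case: (A i l) => x y /=; rewrite mulr0 subr0.
Qed.

Lemma map_mx_Im_mulmx :
  map_mx (@complex.Im R) (A *m map_mx (real_complex R) B)
    = map_mx (@complex.Im R) A *m B.
Proof.
apply/matrixP => i j; rewrite [LHS]mxE 2!mxE raddf_sum; apply: eq_bigr => l _.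
rewrite [map_mx _ B _ _]mxE [map_mx _ A _ _]mxE.
by case: (A i l) => x y /=; rewrite mulr0 add0r.
Qed.

End RealMatrix.

(** * Spectral theory of a real symmetric matrix, through its complexification *)

Section Spectrum.
Variables (R : realType) (n : nat) (M : 'M[R]_n) (lam : n.-tuple R).
Hypothesis M_sym : M^T = M.
Hypothesis lamP : ordered_eigenvalues M lam.

Local Open Scope sesquilinear_scope.
Local Notation C := R[i].
Local Notation toC := (real_complex R).

(** Unitary diagonalization of a Hermitian matrix lists the eigenvalues in an uncontrolled order.
    Comparing characteristic polynomials shows that this list is a permutation of [lam], and
    permuting the rows of the unitary matrix accordingly restores the order. *)
Lemma spectral_ordered : exists2 P : 'M[C]_n, P \is unitarymx &
  P *m map_mx (real_complex R) M
    = diag_mx (\row_i (real_complex R (tnth lam i))) *m P.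
Proof.
set Mc := map_mx _ M.
have Mc_herm : Mc \is hermsymmx.
  apply/is_hermitianmxP; rewrite expr0 scale1r; apply/matrixP => i j.
  by rewrite !mxE -[M in LHS]M_sym mxE; apply/esym/conjc_real.
have /hermitian_normalmx/orthomx_spectralP := Mc_herm.
set P := spectralmx Mc; set d := spectral_diag Mc => Mc_eq.
have uP : P \is unitarymx := spectral_unitarymx Mc.
have PM : P *m Mc = diag_mx d *m P.
  by rewrite {1}Mc_eq !mulmxA mulmxV ?mul1mx // unitarymx_unit.
have Ed : char_poly Mc = \prod_(x <- [seq d 0 i | i <- enum 'I_n]) ('X - x%:P).
  rewrite (char_poly_intertwine (unitarymx_unit uP) PM).
  rewrite char_poly_trig ?diag_mx_is_trig // big_map big_enum /=.
  by apply: eq_bigr => i _; rewrite mxE eqxx.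
have El : char_poly Mc = \prod_(x <- map (real_complex R) lam) ('X - x%:P).
  rewrite -map_char_poly (proj2 lamP) rmorph_prod big_map.
  by apply: eq_bigr => x _; rewrite rmorphB /= map_polyX map_polyC.
have /perm_eq_prod_XsubC := etrans (esym El) Ed.
move/(@tuple_permP _ _ _ (mktuple (d 0))) => [s Es].
exists (row_perm s P).
  apply/row_unitarymxP => i j; have Erow l : row l (row_perm s P) = row (s l) P.
    by apply/rowP => m; rewrite !mxE.
  by rewrite !Erow (row_unitarymxP uP) (inj_eq perm_inj).
have dE i : d 0 (s i) = real_complex R (tnth lam i).
  have := congr1 (nth 0 ^~ i) Es; rewrite (nth_map 0) ?size_tuple //= => lamE.
  rewrite (tnth_nth 0) lamE (nth_map i) ?size_enum_ord //.
  by rewrite nth_ord_enum tnth_mktuple.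
have PME i j : (P *m Mc) (s i) j = real_complex R (tnth lam i) * P (s i) j.
  by rewrite PM mul_diag_mx mxE dE.
apply/matrixP => i j; rewrite mul_diag_mx [LHS]mxE [RHS]mxE.
rewrite [(\row__ _) _ _]mxE [row_perm _ _ _ _ in RHS]mxE -PME mxE.
by apply: eq_bigr => l _; rewrite [row_perm _ _ _ _]mxE.
Qed.

Lemma diag_form m (d : 'rV[R]_m) (v : 'rV[C]_m) :
  (v *m diag_mx (map_mx toC d) *m v^t*) 0 0 = \sum_i toC (d 0 i) * `|v 0 i| ^+ 2.
Proof.
rewrite mul_mx_diag mxE; apply: eq_bigr => i _.
by rewrite !mxE mulrAC normCK mulrC.
Qed.

(* A nonzero combination of the k + 1 rows of W is orthogonal to the first k
   eigenvectors, so its Rayleigh quotient is at least the eigenvalue of index k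
   (counting from 0). *)
Lemma eigenvalue_le_test k (W : 'M[R]_(k.+1, n)) (a b : 'rV[R]_k.+1) :
  (k < n)%N -> W *m M *m W^T = diag_mx a -> W *m W^T = diag_mx b ->
  exists j, nth 0 lam k * b 0 j <= a 0 j.
Proof.
move=> ltkn WMW WW; have [P uP PM] := spectral_ordered.
set Mc := map_mx _ M in PM.
set D := diag_mx _ in PM; set Wc := map_mx toC W.
(* Row [i] of [B] holds the coordinates of row [i] of [W] in the eigenbasis. Keeping only the first
   [k] columns leaves rank at most [k < k.+1], hence a nonzero [x] in the left kernel. *)
pose B := Wc *m P^t*.
pose Bk := \matrix_(i < k.+1, j < k) B i (widen_ord (ltnW ltkn) j).
have : kermx Bk != 0.
  by rewrite kermx_eq0 /row_free neq_ltn (leq_ltn_trans (rank_leq_col _)).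
case/rowV0Pn => x /sub_kermxP xBk x_neq0.
pose y := x *m Wc; pose z := y *m P^t*.
have z0 (i : 'I_n) : (i < k)%N -> z 0 i = 0.
  move=> ltik; have /matrixP/(_ 0 (Ordinal ltik)) := xBk.
  rewrite [RHS]mxE => <-; rewrite /z /y -mulmxA !mxE.
  by apply: eq_bigr => l _; rewrite [in RHS]mxE; congr (_ * B _ _); apply: val_inj.
have PP : P^t* *m P = 1%:M by apply: mulmx1C; apply/unitarymxP.
have Wct : Wc^t* = map_mx toC W^T.
  by apply/matrixP => i j; rewrite !mxE; apply: conjc_real.
have E1 : z *m D *m z^t* = x *m diag_mx (map_mx toC a) *m x^t*.
  rewrite -map_diag_mx -WMW !map_mxM -Wct /z /y !trmx_mul !map_mxM trmxCK.
  by rewrite !mulmxA -(mulmxA _ D) -PM mulmxA -(mulmxA _ _ P) PP mulmx1.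
have E2 : z *m z^t* = x *m diag_mx (map_mx toC b) *m x^t*.
  rewrite -map_diag_mx -WW !map_mxM -Wct /z /y !trmx_mul !map_mxM trmxCK.
  by rewrite !mulmxA -(mulmxA _ _ P) PP mulmx1.
(* Negated, the claim makes [a 0 j] smaller than the eigenvalue times [b 0 j] for every [j]. Summing
   with weights [|x 0 j|^2], not all zero, contradicts the lower bound on the form at [z]. *)
apply/existsP; apply: contraTT isT => /existsPn/= lt_ab.
have {}E2 : \sum_i `|z 0 i| ^+ 2 = \sum_j toC (b 0 j) * `|x 0 j| ^+ 2.
  by rewrite -diag_form -E2 mxE; apply: eq_bigr => i _; rewrite !mxE normCK.
have {}E1 : \sum_i toC (tnth lam i) * `|z 0 i| ^+ 2
    = \sum_j toC (a 0 j) * `|x 0 j| ^+ 2.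
  rewrite -[RHS]diag_form -E1 (_ : D = diag_mx (map_mx toC (\row_i tnth lam i))).
    by rewrite diag_form; apply: eq_bigr => i _; rewrite mxE.
  by congr diag_mx; apply/rowP => i; rewrite !mxE.
(* Coordinates of [z] below index [k] vanish, and from [k] on the eigenvalues are at least that of
   index [k]. *)
have : toC (nth 0 lam k) * (\sum_i `|z 0 i| ^+ 2)
    <= \sum_i toC (tnth lam i) * `|z 0 i| ^+ 2.
  rewrite mulr_sumr; apply: ler_sum => i _.
  have [ltik|leki] := ltnP i k; first by rewrite z0 // normr0 expr0n !mulr0.
  rewrite ler_wpM2r ?exprn_ge0 // lecR (tnth_nth 0).
  apply: (sorted_leq_nth le_trans lexx 0 (proj1 lamP)) => //;
    by rewrite inE size_tuple.
rewrite {}E1 {}E2 mulr_sumr => le_ba.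
suff /(le_lt_trans le_ba) : \sum_j toC (a 0 j) * `|x 0 j| ^+ 2
    < \sum_j toC (nth 0 lam k) * (toC (b 0 j) * `|x 0 j| ^+ 2) by rewrite ltxx.
have [j xj_neq0] : exists j, x 0 j != 0.
  apply/existsP; apply: contraNT x_neq0 => /existsPn x0.
  by apply/eqP/rowP => j; rewrite mxE; apply/eqP/negPn/x0.
rewrite (bigD1 j) //= [ltRHS](bigD1 j) //= ltr_leD //.
  rewrite mulrA -rmorphM ltr_pM2r ?exprn_gt0 ?normr_gt0 // ltcR ltNge.
  exact: lt_ab.
apply: ler_sum => i _; rewrite mulrA -rmorphM ler_wpM2r ?exprn_ge0 // lecR.
by rewrite ltW // ltNge lt_ab.
Qed.

(** Vanishing at coordinate [j] is one linear condition on a complex eigenspace of dimension at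
    least two. Since [M] and [mu] are real, the real and imaginary parts of a solution are again
    solutions, and one of them is nonzero. *)
Lemma repeated_eigenvalue_vector (mu : R) (i0 i1 j : 'I_n) : i0 != i1 ->
  tnth lam i0 = mu -> tnth lam i1 = mu ->
  exists v : 'rV[R]_n, [/\ v != 0, v *m M = mu *: v & v 0 j = 0].
Proof.
move=> i01 mu0 mu1; have [P uP PM] := spectral_ordered.
pose f (i : 'I_2) := if i == 0 then i0 else i1.
have f_inj : injective f.
  move=> [[|[|//]] ?] [[|[|//]] ?]; rewrite /f -!val_eqE /= => E;
    by [apply: val_inj | rewrite E eqxx in i01].
pose W := rowsub f P.
have uW : W \is unitarymx.
  apply/row_unitarymxP => i l.
  by rewrite !row_rowsub (row_unitarymxP uP) (inj_eq f_inj).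
have WM : W *m map_mx toC M = toC mu *: W.
  apply/matrixP => i l; have /matrixP/(_ (f i) l) := PM.
  rewrite mul_diag_mx [RHS]mxE [(\row__ _) _ _]mxE => E.
  transitivity ((P *m map_mx toC M) (f i) l).
    by rewrite !mxE; apply: eq_bigr => m _; rewrite [W _ _]mxE.
  by rewrite E [RHS]mxE [W _ _]mxE /f; case: ifP => _; rewrite ?mu0 ?mu1.
(* A column with two entries has rank at most one, so some nonzero combination of the two
   eigenvectors vanishes at [j]. *)
have : kermx (col j W) != 0.
  by rewrite kermx_eq0 /row_free neq_ltn (leq_ltn_trans (rank_leq_col _)).
case/rowV0Pn => x /sub_kermxP xWj x_neq0; pose y := x *m W.
have yM : y *m map_mx toC M = toC mu *: y by rewrite -mulmxA WM scalemxAr.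
have y_neq0 : y != 0.
  by rewrite mulmx_free_eq0 // /row_free mxrank_unitary.
have yj : y 0 j = 0.
  have /matrixP/(_ 0 0) := xWj; rewrite [RHS]mxE => <-.
  by rewrite /y !mxE; apply: eq_bigr => l _; rewrite [col _ _ _ _]mxE.
clearbody y; pose yr := map_mx (@complex.Re R) y.
pose yi := map_mx (@complex.Im R) y.
have [yr0|yr_neq0] := eqVneq yr 0; last first.
  exists yr; split=> //; last by rewrite mxE yj.
  rewrite -map_mx_Re_mulmx yM; apply/rowP => l; rewrite !mxE.
  by case: (y 0 l) => c d /=; rewrite mul0r subr0.
exists yi; split=> //; last by rewrite mxE yj.
  apply: contra_neq y_neq0 => yi0; apply/matrixP => i l.
  move/matrixP/(_ i l): yr0; move/matrixP/(_ i l): yi0.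
  by rewrite !mxE; case: (y i l) => /= ? ? -> ->.
rewrite -map_mx_Im_mulmx yM; apply/rowP => l; rewrite !mxE.
by case: (y 0 l) => c d /=; rewrite mul0r addr0.
Qed.

Lemma eigenvalue_vector (i : 'I_n) :
  exists2 v : 'rV[R]_n, v != 0 & v *m M = tnth lam i *: v.
Proof.
suff /eigenvalueP[v] : eigenvalue M (tnth lam i) by exists v.
by rewrite eigenvalue_root_char (proj2 lamP) root_prod_XsubC mem_tnth.
Qed.

End Spectrum.

(** * Volumes and the quadratic form of the normalized Laplacian *)

Section GraphForm.
Variables (V : finType) (e : rel V).
Hypothesis e_sym : symmetric e.

Definition volume (A : {set V}) : nat := \sum_(x in A) degree e x.
(* Counts ordered pairs, so each edge inside A contributes 2. *)
Definition edges_within (A : {set V}) : nat :=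
  \sum_(x in A) \sum_(y in A) e x y.

Lemma degreeE x : degree e x = (\sum_y e x y)%N.
Proof.
rewrite /degree -sum1_card big_mkcond; apply: eq_bigr => y _.
by rewrite inE; case: e.
Qed.

(* The edges leaving A end in B outside A.  The number of these edges is
   volume A - edges_within A; the inequality avoids natural subtraction. *)
Lemma volume_boundary (A B : {set V}) :
  A \subset B -> (forall x y, x \in A -> e x y -> y \in B) ->
  (volume A + volume A <= volume B + edges_within A)%N.
Proof.
move=> sAB nAB.
have -> : volume B = (volume A + \sum_(y in B :\: A) degree e y)%N.
  by rewrite /volume (big_setID A) /= (setIidPr sAB).
have {2}-> : volume A = (edges_within A + \sum_(x in A) \sum_(y in ~: A) e x y)%N.
  rewrite -big_split; apply: eq_bigr => x _; rewrite degreeE (bigID (mem A)) /=.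
  by congr addn; apply: eq_bigl => y; rewrite inE.
(* Edges leaving [A] are now counted at their outer endpoint [y]: at most [degree e y] of them if
   [y] is in [B], and none otherwise. *)
rewrite -addnA leq_add2l addnC leq_add2r exchange_big.
rewrite [leqRHS]big_mkcond [leqLHS]big_mkcond /=; apply: leq_sum => y _.
rewrite !inE; case: (y \in A) => //=; case: ifP => [_|ynB].
  rewrite degreeE [leqLHS]big_mkcond /=; apply: leq_sum => x _.
  by rewrite e_sym; case: ifP.
by rewrite big1 // => x xA; case exy: (e x y) => //; rewrite (nAB x) in ynB.
Qed.

Lemma volume_le (A : {set V}) : (volume A <= #|V| ^ 2)%N.
Proof.
rewrite expnS expn1 -sum_nat_const /volume big_mkcond.
by apply: leq_sum => x _; case: ifP => // _; apply: max_card.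
Qed.

Variable R : realType.
Local Notation L := (normalized_laplacian R e).
Local Notation deg x := ((degree e x)%:R : R).

Lemma laplacian_sym : L^T = L.
Proof.
rewrite /normalized_laplacian linearB /= trmx1 !trmx_mul tr_diag_mx mulmxA.
congr (_ - _ *m _ *m _); apply/matrixP => i j; rewrite !mxE e_sym //.
Qed.

Lemma sum_enum_val (F : V -> R) : \sum_(i < #|V|) F (enum_val i) = \sum_x F x.
Proof. by rewrite [RHS](reindex _ (onW_bij _ (@enum_val_bij V))). Qed.

(** The row vector [D^(1/2) f]; the weight cancels both factors [D^(-1/2)] of the Laplacian. *)
Definition weighted_row (f : V -> R) : 'rV[R]_#|V| :=
  \row_i (Num.sqrt (deg (enum_val i)) * f (enum_val i)).

Hypothesis deg_gt0 : forall x, (0 < degree e x)%N.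

Lemma sqrt_deg_gt0 x : 0 < Num.sqrt (deg x).
Proof. by rewrite sqrtr_gt0 ltr0n. Qed.

Lemma weighted_row_surj (v : 'rV[R]_#|V|) : exists f, v = weighted_row f.
Proof.
exists (fun x => v 0 (enum_rank x) / Num.sqrt (deg x)).
apply/rowP => i; rewrite mxE enum_valK mulrCA divff ?mulr1 //.
by rewrite gt_eqF // sqrt_deg_gt0.
Qed.

Lemma weighted_row_dot f g :
  (weighted_row f *m (weighted_row g)^T) 0 0 = \sum_x deg x * (f x * g x).
Proof.
rewrite mxE -[RHS]sum_enum_val; apply: eq_bigr => i _; rewrite !mxE.
by rewrite mulrACA -expr2 sqr_sqrtr ?ler0n.
Qed.

Lemma laplacian_form f g :
  (weighted_row f *m L *m (weighted_row g)^T) 0 0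
    = \sum_x deg x * (f x * g x) - \sum_x \sum_y (e x y)%:R * (f x * g y).
Proof.
have fD h : weighted_row h *m degree_invsqrt_mx R e = \row_i h (enum_val i).
  apply/rowP => i; rewrite mul_mx_diag !mxE mulrAC divff ?mul1r //.
  by rewrite gt_eqF // sqrt_deg_gt0.
have Df : degree_invsqrt_mx R e *m (weighted_row g)^T = (\row_i g (enum_val i))^T.
  by rewrite -fD trmx_mul tr_diag_mx.
rewrite mulmxBr mulmxBl mulmx1 mxE weighted_row_dot !mulmxA fD -mulmxA Df.
rewrite [in LHS]mxE; congr (_ - _); rewrite mxE.
rewrite exchange_big -[RHS]sum_enum_val; apply: eq_bigr => j _.
rewrite mxE mulr_suml -[RHS]sum_enum_val; apply: eq_bigr => i _.
by rewrite !mxE mulrA; congr (_ * _); rewrite mulrC.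
Qed.

(** Meant for [c = -1], where the sum is twice the Laplacian form and shows it nonnegative, and for
    [c = 1], where nonnegativity of the sum bounds the Laplacian form by twice the squared norm. *)
Lemma sum_edges_sqr (c : R) f : c ^+ 2 = 1 ->
  \sum_x \sum_y (e x y)%:R * (f x + c * f y) ^+ 2
    = (\sum_x deg x * (f x * f x)
       + c * \sum_x \sum_y (e x y)%:R * (f x * f y)) *+ 2.
Proof.
move=> c2.
have degf x : deg x * (f x * f x) = \sum_y (e x y)%:R * (f x * f x).
  by rewrite degreeE natr_sum mulr_suml.
have E1 : \sum_x deg x * (f x * f x) = \sum_x \sum_y (e x y)%:R * (f x * f x).
  by apply: eq_bigr => x _.
have E2 : \sum_x deg x * (f x * f x) = \sum_x \sum_y (e x y)%:R * (f y * f y).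
  rewrite exchange_big E1; apply: eq_bigr => x _; apply: eq_bigr => y _.
  by rewrite e_sym.
rewrite mulrnDl {1}mulr2n {1}E1 E2 mulr_sumr -sumrMnl -!big_split /=.
apply: eq_bigr => x _; rewrite mulr_sumr -sumrMnl -!big_split /=.
apply: eq_bigr => y _; rewrite sqrrD exprMn c2; ring.
Qed.

Lemma laplacian_form_sqr f :
  (weighted_row f *m L *m (weighted_row f)^T) 0 0 *+ 2
    = \sum_x \sum_y (e x y)%:R * (f x - f y) ^+ 2.
Proof.
rewrite laplacian_form -mulN1r -sum_edges_sqr ?sqrrN ?expr1n //.
by apply: eq_bigr => x _; apply: eq_bigr => y _; rewrite mulN1r.
Qed.

Lemma laplacian_form_le f :
  (weighted_row f *m L *m (weighted_row f)^T) 0 0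
    <= 2 * (weighted_row f *m (weighted_row f)^T) 0 0.
Proof.
rewrite laplacian_form weighted_row_dot.
have : 0 <= \sum_x \sum_y (e x y)%:R * (f x + 1 * f y) ^+ 2.
  by do 2!apply: sumr_ge0 => ? _; rewrite mulr_ge0 ?sqr_ge0.
rewrite sum_edges_sqr ?expr1n //; lra.
Qed.

Lemma laplacian_eigenvalue_bounds (v : 'rV[R]_#|V|) mu :
  v != 0 -> v *m L = mu *: v -> 0 <= mu <= 2.
Proof.
have [f ->] := weighted_row_surj v => f_neq0 Lf.
have norm_gt0 : 0 < (weighted_row f *m (weighted_row f)^T) 0 0.
  rewrite mxE; have [i fi] : exists i, weighted_row f 0 i != 0.
    apply/existsP; apply: contraNT f_neq0 => /existsPn f0.
    by apply/eqP/rowP => i; rewrite [RHS]mxE; apply/eqP/negPn/f0.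
  rewrite (bigD1 i) //= ltr_pwDl //.
    by rewrite [_^T _ _]mxE -expr2 exprn_even_gt0.
  by apply: sumr_ge0 => l _; rewrite [_^T _ _]mxE -expr2 sqr_ge0.
have := laplacian_form_le f; have := laplacian_form_sqr f.
rewrite Lf -scalemxAl mxE => E; rewrite ler_pM2r // => ->; rewrite andbT.
rewrite -(pmulr_lge0 _ norm_gt0) -(pmulrn_lge0 _ (n := 2)) // E.
by do 2!apply: sumr_ge0 => ? _; rewrite mulr_ge0 ?sqr_ge0.
Qed.

(** The form at [v] is a sum of nonnegative edge terms equal to 0, so [f] is constant along edges
    and its zero spreads along paths to every vertex. *)
Lemma laplacian_kernel (v : 'rV[R]_#|V|) i :
  graph_connected e -> v *m L = 0 -> v 0 i = 0 -> v = 0.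
Proof.
have [f ->] := weighted_row_surj v => e_conn Lf; rewrite mxE => /eqP.
rewrite mulf_eq0 gt_eqF ?sqrt_deg_gt0 //= => /eqP fi0.
have f_const x y : e x y -> f x = f y.
  move=> exy; apply/eqP; rewrite -subr_eq0 -sqrf_eq0; apply/eqP.
  have := laplacian_form_sqr f; rewrite Lf mul0mx mxE mul0rn => /esym.
  have ge0 a b : 0 <= (e a b)%:R * (f a - f b) ^+ 2 by rewrite mulr_ge0 ?sqr_ge0.
  move/psumr_eq0P => /(_ (fun a _ => sumr_ge0 _ (fun b _ => ge0 a b)) x isT).
  by move/psumr_eq0P => /(_ (fun b _ => ge0 x b) y isT); rewrite exy mul1r.
have f0 x : f x = 0.
  have /connectP[p] := e_conn (enum_val i) x; elim/last_ind: p x => [|p z IHp] x.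
    by move=> _ ->.
  rewrite rcons_path last_rcons => /andP[ep /f_const fz] ->.
  by rewrite -fz; apply: IHp.
by apply/rowP => l; rewrite !mxE f0 mulr0.
Qed.

End GraphForm.

(** * Separated test sets and the growth of bands *)

Lemma mulmx_tr_row (R : comPzRingType) m n (A : 'M[R]_(m, n)) (B : 'M[R]_n) j l :
  (A *m B *m A^T) j l = (row j A *m B *m (row l A)^T) 0 0.
Proof.
rewrite -row_mul [LHS]mxE [RHS]mxE; apply: eq_bigr => i _.
by congr (_ * _); [rewrite [RHS]mxE | rewrite !mxE].
Qed.

Section TestSets.
Variables (R : realType) (V : finType) (e : rel V).
Hypotheses (e_sym : symmetric e) (deg_gt0 : forall x, (0 < degree e x)%N).
Variable lambda : #|V|.-tuple R.
Hypothesis lambdaP : ordered_eigenvalues (normalized_laplacian R e) lambda.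

(** Separation makes both Gram matrices of the rows [D^(1/2) 1_(S j)] diagonal, so
    [eigenvalue_le_test] applies. The right-hand side is the number of edges leaving [S j]. *)
Lemma eigenvalue_le_test_sets k (S : 'I_k.+1 -> {set V}) : (k < #|V|)%N ->
  (forall j l x y, j != l -> x \in S j -> y \in S l -> x != y /\ ~~ e x y) ->
  exists j, nth 0 lambda k * (volume e (S j))%:R
    <= (volume e (S j))%:R - (edges_within e (S j))%:R.
Proof.
move=> ltk sep; pose ind j x : R := (x \in S j)%:R.
pose W := \matrix_j weighted_row e (ind j).
pose b := \row_j ((volume e (S j))%:R : R).
pose a := \row_j ((volume e (S j))%:R - (edges_within e (S j))%:R : R).
have dotE j l : \sum_x (degree e x)%:R * (ind j x * ind l x) = b 0 j *+ (j == l).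
  case: eqVneq => [<-|jl]; rewrite ?mulr0n.
    rewrite mxE natr_sum [RHS]big_mkcond; apply: eq_bigr => x _.
    by rewrite /ind; case: ifP; rewrite ?mulr1 ?mul0r ?mulr0.
  apply: big1 => x _; rewrite /ind; case: (boolP (x \in S j)) => [xj|_]; last first.
    by rewrite mul0r mulr0.
  case: (boolP (x \in S l)) => [xl|_]; last by rewrite !mulr0.
  by have [] := sep _ _ _ _ jl xj xl; rewrite eqxx.
have formE j l : \sum_x \sum_y (e x y)%:R * (ind j x * ind l y)
    = (edges_within e (S j))%:R *+ (j == l).
  case: eqVneq => [<-|jl]; rewrite ?mulr0n.
    rewrite natr_sum [RHS]big_mkcond; apply: eq_bigr => x _.
    case: ifP => xj; last by apply: big1 => y _; rewrite /ind xj mul0r mulr0.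
    rewrite natr_sum [RHS]big_mkcond; apply: eq_bigr => y _.
    by rewrite /ind xj mul1r; case: ifP; rewrite ?mulr1 ?mulr0.
  apply: big1 => x _; apply: big1 => y _; rewrite /ind.
  case: (boolP (x \in S j)) => [xj|_]; last by rewrite mul0r mulr0.
  case: (boolP (y \in S l)) => [yl|_]; last by rewrite !mulr0.
  by have [_ /negPf->] := sep _ _ _ _ jl xj yl; rewrite mul0r.
have WLW : W *m normalized_laplacian R e *m W^T = diag_mx a.
  apply/matrixP => j l; rewrite mulmx_tr_row !rowK laplacian_form // dotE formE.
  by rewrite -mulrnBl !mxE.
have WW : W *m W^T = diag_mx b.
  apply/matrixP => j l; rewrite -[W in W *m _]mulmx1 mulmx_tr_row !rowK mulmx1.
  by rewrite weighted_row_dot dotE !mxE.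
have [j] := eigenvalue_le_test (laplacian_sym e_sym R) lambdaP ltk WLW WW.
by rewrite !mxE; exists j.
Qed.

Variable h : V -> nat.
Hypothesis h_lip : forall x y, e x y -> (h y <= (h x).+1)%N.

(** The condition is [|h x - m| <= i], written without truncated subtraction. *)
Definition band (m i : nat) : {set V} :=
  [set x | (h x <= m + i) && (m <= h x + i)]%N.

(** Neighbours of a band lie in the band of radius one larger, so by [volume_boundary] the volume
    grows by at least the number of boundary edges, that is by a factor [1 + mu]. At radius 0 the
    band contains [x], of positive degree. *)
Lemma volume_band_growth (mu : R) m r : 0 <= mu -> (exists x, h x = m) ->
  (forall i : 'I_r, mu * (volume e (band m i))%:R
     <= (volume e (band m i))%:R - (edges_within e (band m i))%:R) ->
  (1 + mu) ^+ r <= (volume e (band m r))%:R.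
Proof.
move=> mu_ge0 [x hx]; elim: r => [|r IHr] mu_le.
  rewrite expr0 ler1n /volume (bigD1 x) ?addn_gt0 ?deg_gt0 //=.
  by rewrite inE hx addn0 leqnn.
have {IHr} := IHr (fun i => mu_le (widen_ord (leqnSn r) i)).
have := mu_le ord_max; rewrite /=.
have : (volume e (band m r) + volume e (band m r)
    <= volume e (band m r.+1) + edges_within e (band m r))%N.
  apply: volume_boundary => //.
    by apply/subsetP => y; rewrite !inE; lia.
  move=> y z; rewrite !inE => yA eyz; have := h_lip eyz.
  by have := h_lip (etrans (e_sym z y) eyz); lia.
rewrite -(ler_nat R) !natrD exprS; set p := _ ^+ r; nra.
Qed.

Lemma eigenvalue_power_le k r : (k < #|V|)%N -> 0 <= nth 0 lambda k ->
  (forall m, (m <= 2 * r * k)%N -> exists x, h x = m) ->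
  (1 + nth 0 lambda k) ^+ r <= #|V|%:R ^+ 2.
Proof.
move=> ltk lam_ge0 h_surj; set mu := nth 0 lambda k.
pose good j (i : 'I_r) := mu * (volume e (band (2 * r * j) i))%:R
  <= (volume e (band (2 * r * j) i))%:R
     - (edges_within e (band (2 * r * j) i))%:R.
have [j j_good] : exists j : 'I_k.+1, forall i, good j i.
  suff /existsP[j /forallP j_good] :
    [exists j : 'I_k.+1, [forall i, good j i]] by exists j.
  apply: contraT => /existsPn/= bad.
  (* If each centre had a failing radius, the bands with these radii, which may differ between
     centres, would violate [eigenvalue_le_test_sets]. *)
  have bad_ex (j : 'I_k.+1) : {i : 'I_r | ~~ good j i}.
    by apply: sigW; apply/existsP; rewrite -negb_forall; apply: bad.
  pose S (j : 'I_k.+1) := band (2 * r * j) (sval (bad_ex j)).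
  have [j l x y jl|j] := @eigenvalue_le_test_sets k S ltk.
    have := ltn_ord (sval (bad_ex j)); have := ltn_ord (sval (bad_ex l)).
    rewrite !inE => ltl ltj xS yS.
    have step (a b : nat) : (a < b -> 2 * r * a + 2 * r <= 2 * r * b)%N.
      by move=> ltab; rewrite -mulnSr leq_mul2l ltab orbT.
    (* Centres are at least [2 * r] apart and radii at most [r - 1], so values of [h] on distinct
       bands differ by at least 2. This excludes both equality and adjacency. *)
    have sep : ((h x).+1 < h y)%N \/ ((h y).+1 < h x)%N.
      by move: jl; rewrite -val_eqE neq_ltn => /orP[/step|/step] /=; lia.
    split; first by apply/eqP => xy; move: sep; rewrite xy; lia.
    apply/negP => exy; have := h_lip exy.
    by have := h_lip (etrans (e_sym y x) exy); lia.
  by rewrite -[_ <= _]/(good j _) (negPf (svalP (bad_ex j))).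
apply: le_trans (volume_band_growth lam_ge0 _ j_good) _.
  by apply: h_surj; rewrite leq_mul2l -ltnS ltn_ord orbT.
by rewrite -natrX ler_nat volume_le.
Qed.

End TestSets.

(** * Distances, paths and degrees *)

Section Dist.
Variables (V : finType) (e : rel V).

(** Shortening [p] to a path without repeated vertices brings its length below [#|V|], into the
    range of the minimum defining [dist]. *)
Lemma dist_le_size u p : path e u p -> (dist e u (last u p) <= size p)%N.
Proof.
move=> ep; case: (shortenP ep) => q eq uq sub_qp.
have ltq : (size q < #|V|)%N.
  by rewrite -[(size q).+1]/(size (u :: q)) -(card_uniqP uq) max_card.
apply: leq_trans _ (uniq_leq_size (proj2 (andP uq)) sub_qp).
have dist_q : has_path e u (last u q) (Ordinal ltq).
  by apply/existsP; exists (in_tuple q); rewrite eq eqxx uq.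
have := bigmin_le_cond #|V| (fun d : 'I_#|V| => d : nat)
  (P := fun d : 'I_#|V| => has_path e u (last u q) d) dist_q.
by rewrite minEnat leEnat.
Qed.

Lemma dist_attained u v : dist e u v = #|V| \/
  exists p, [/\ path e u p, last u p = v & size p = dist e u v].
Proof.
rewrite /dist; elim/big_ind: _ => [|m n IHm IHn|d]; first by left.
  by rewrite /minn; case: ifP.
by case/existsP => p /and3P[ep /eqP lp _]; right; exists p; rewrite size_tuple.
Qed.

Lemma dist_edge u x y : e x y -> (dist e u y <= (dist e u x).+1)%N.
Proof.
move=> exy; case: (dist_attained u x) => [->|[p [ep lp <-]]].
  (* If [dist e u x] is the default [#|V|], no minimum started at [#|V|] exceeds it. *)
  apply: leqW; exact: (bigmin_le_id _ #|V| _ (fun d : 'I_#|V| => d : nat)).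
have := @dist_le_size u (rcons p y); rewrite rcons_path last_rcons size_rcons.
by rewrite ep lp exy; apply.
Qed.

Lemma dist_refl u : dist e u u = 0%N.
Proof. by apply/eqP; rewrite -leqn0; apply: (@dist_le_size u [::]). Qed.

End Dist.

(** Since [h] rises by at most one per edge, it cannot jump over [m] on the way up. *)
Lemma path_intermediate_value (V : eqType) (e : rel V) (h : V -> nat) m x p :
  (forall y z, e y z -> (h z <= (h y).+1)%N) -> path e x p ->
  (h x <= m <= h (last x p))%N -> exists y, h y = m.
Proof.
move=> h_lip; elim: p x => [|y p IHp] x /=.
  by move=> _; rewrite -eqn_leq => /eqP; exists x.
case/andP=> /h_lip lexy ep /andP[lexm lem].
have [ltxm|] := ltnP (h x) m.
  by apply: (IHp y) => //; rewrite lem (leq_trans lexy).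
by exists x; apply/eqP; rewrite eqn_leq lexm.
Qed.

Lemma diam_attained (V : finType) (e : rel V) : (0 < #|V|)%N ->
  exists u v, diam e = dist e u v.
Proof.
move=> V_gt0; rewrite /diam.
have [u ->] := @bigop.eq_bigmax V (fun u : V => \max_(v : V) dist e u v) V_gt0.
by have [v ->] := @bigop.eq_bigmax V (dist e u) V_gt0; exists u, v.
Qed.

Lemma connected_degree_gt0 (V : finType) (e : rel V) :
  graph_connected e -> (1 < #|V|)%N -> forall x, (0 < degree e x)%N.
Proof.
move=> e_conn V_gt1 x; have [y] : exists y, y \in [set~ x].
  by apply/set0Pn; rewrite -card_gt0 cardsC1 -ltnS prednK // ltnW.
rewrite !inE => y_neq_x; have /connectP[[|z p] /=] := e_conn x y.
  by move=> _ yx; rewrite yx eqxx in y_neq_x.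
by case/andP=> exz _ _; rewrite card_gt0; apply/set0Pn; exists z; rewrite inE.
Qed.

(** * Logarithmic estimates and the diameter bound *)

Lemma mul_le_ln (R : realType) (mu : R) (r n : nat) : 0 <= mu <= 2 -> (0 < n)%N ->
  (1 + mu) ^+ r <= n%:R ^+ 2 -> r%:R * mu <= 6 * ln n%:R.
Proof.
case/andP=> mu_ge0 mu_le2 n_gt0 le_n.
have mu1_gt0 : 0 < 1 + mu by lra.
have n_gt0' : 0 < n%:R :> R by rewrite ltr0n.
(* From [ln y <= y - 1] at [y = 1 / (1 + mu)]: [ln (1 + mu) >= mu / (1 + mu)], and [1 + mu <= 3].
   With the exponent 2 of [n] this gives the constant 6. *)
have ln_ge : mu / 3 <= ln (1 + mu).
  have inv_gt0 : 0 < (1 + mu)^-1 by rewrite invr_gt0.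
  have inv_mul : (1 + mu) * (1 + mu)^-1 = 1 by rewrite divff ?gt_eqF.
  have : ln (1 + ((1 + mu)^-1 - 1)) <= (1 + mu)^-1 - 1 by apply: le_ln1Dx; lra.
  rewrite addrC subrK lnV ?posrE // => ln_le; nra.
have : ln ((1 + mu) ^+ r) <= ln (n%:R ^+ 2) by rewrite ler_ln ?posrE ?exprn_gt0.
rewrite !lnXn // -mulr_natl -[leRHS]mulr_natl.
have : (0 : R) <= r%:R by [].
nra.
Qed.

Theorem theorem1 (R : realType) (V : finType) (e : rel V)
    (e_sym : symmetric e) (e_irr : irreflexive e)
    (e_conn : graph_connected e)
    (lambda : #|V|.-tuple R)
    (lambdaP : ordered_eigenvalues (normalized_laplacian R e) lambda)
    (k : nat) (k_ge2 : (2 <= k)%N) (k_len : (k <= #|V|)%N) :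
  (diam e)%:R <= 48%:R * k%:R * ln (#|V|%:R : R) / nth 0 lambda k.-1.
Proof.
have V_gt1 : (1 < #|V|)%N := leq_trans k_ge2 k_len.
have V_gt0 : (0 < #|V|)%N := ltnW V_gt1.
have deg_gt0 := connected_degree_gt0 e_conn V_gt1.
(* From here on [k] is one less than in the statement: the index, counted from 0, of the eigenvalue
   concerned. *)
case: k k_ge2 k_len => // k k_gt0 ltk; rewrite ltnS in k_gt0; rewrite [k.+1.-1]/=.
have lam_bounds (i : 'I_#|V|) : 0 <= tnth lambda i <= 2.
  have [v] := eigenvalue_vector lambdaP i.
  exact: laplacian_eigenvalue_bounds.
have lam_gt0 : 0 < nth 0 lambda k.
  (* Otherwise 0 is a double eigenvalue, and a kernel vector vanishing at one
     vertex vanishes everywhere since the graph is connected. *)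
  pose i0 := Ordinal V_gt0; pose i1 := Ordinal V_gt1.
  have lam_mono i j : (i <= j < #|V|)%N -> nth 0 lambda i <= nth 0 lambda j.
    case/andP=> leij ltj; apply: (sorted_leq_nth le_trans lexx 0 (proj1 lambdaP));
      by rewrite ?inE ?size_tuple // (leq_ltn_trans leij).
  apply: lt_le_trans (lam_mono 1%N k _); last by rewrite k_gt0.
  rewrite -[1%N]/(val i1) -tnth_nth lt_def.
  have /andP[-> _] := lam_bounds i1; rewrite andbT; apply/eqP => lam1.
  have lam0 : tnth lambda i0 = 0.
    apply/eqP; rewrite eq_le; have /andP[-> _] := lam_bounds i0.
    by rewrite andbT -lam1 !(tnth_nth 0) lam_mono.
  have [v [v_neq0]] := repeated_eigenvalue_vector (laplacian_sym e_sym R) lambdaP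
    i0 (isT : i0 != i1) lam0 lam1.
  rewrite scale0r => Lv vi; case/eqP: v_neq0.
  exact: laplacian_kernel e_conn Lv vi.
have lam_le2 : nth 0 lambda k <= 2.
  by have /andP[_] := lam_bounds (Ordinal ltk); rewrite (tnth_nth 0).
have [u [v diamE]] := diam_attained e V_gt0.
(* The largest [r] for which the last centre [2 * r * k] is still at most the diameter, hence a
   value of [dist e u]. *)
pose r := (diam e %/ (2 * k))%N.
have h_surj m : (m <= 2 * r * k)%N -> exists x, dist e u x = m.
  move=> lem; have /connectP[p ep lp] := e_conn u v.
  apply: (path_intermediate_value (@dist_edge V e u) ep).
  by rewrite dist_refl -lp -diamE (leq_trans lem) // -mulnA mulnCA leq_divM.
have ler : r%:R * nth 0 lambda k <= 6 * ln (#|V|%:R : R).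
  apply: mul_le_ln => //; first by rewrite ltW.
  exact: (eigenvalue_power_le e_sym deg_gt0 lambdaP (@dist_edge V e u) ltk
    (ltW lam_gt0)).
(* By [ln y <= y - 1] at [y = 1 / #|V|] with [#|V| >= 2]. This lets the logarithm absorb the
   rounding in [r]. *)
have ln_ge : (2^-1 : R) <= ln #|V|%:R.
  have inv_le : (#|V|%:R^-1 : R) <= 2^-1.
    by rewrite lef_pV2 ?posrE ?ltr0n // ler_nat.
  have inv_gt0 : 0 < (#|V|%:R^-1 : R) by rewrite invr_gt0 ltr0n.
  have : ln (1 + ((#|V|%:R)^-1 - 1)) <= (#|V|%:R)^-1 - 1 :> R.
    by apply: le_ln1Dx; lra.
  rewrite addrC subrK lnV ?posrE ?ltr0n //; lra.
have diam_lt : (diam e <= 2 * k * r.+1)%N.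
  by apply: ltnW; rewrite mulnC ltn_ceil // muln_gt0.
rewrite ler_pdivlMr //.
have : (diam e)%:R <= 2 * k%:R * (r%:R + 1) :> R.
  by rewrite (natr1 r) -!natrM ler_nat.
have k_ge0 : 0 <= k%:R :> R by [].
rewrite -(natr1 k); move: ler ln_ge lam_gt0 lam_le2.
move: (nth _ _ _) (ln _) (k%:R) (r%:R) k_ge0 => l t kk rr kk0 h1 h2 h3 h4 h5.
(* Here [l] is the eigenvalue and [t] the logarithm. As [l <= 2 <= 4 * t], the product of diameter
   and eigenvalue is at most [20 * kk * t], well below the required [48 * (kk + 1) * t]. *)
have h6 : 2 * kk * (rr + 1) * l <= 2 * kk * (6 * t + 2) by nra.
have h7 : (diam e)%:R * l <= 2 * kk * (rr + 1) * l by nra.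
nra.
Qed.
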